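(* Let $a, c$ be nonnegative integers. Then there exists a unique nonnegative integer $b$ such that $\mathcal{G}_{\mathcal{R}}(b,a+b) = c$.
   Context: A position is an unordered pair $(a,b)$ of nonnegative integers (pile sizes). $\mathcal{R}$-Wythoff: a move either removes a positive number of tokens from the larger pile (or from either pile if both piles have equal size), or removes the same positive number of tokens from both piles. $\mathcal{G}_{\mathcal{R}}$ is the Sprague-Grundy function of $\mathcal{R}$-Wythoff: $\mathcal{G}_{\mathcal{R}}(p)=\mathrm{mex}\{\mathcal{G}_{\mathcal{R}}(q): q \text{ reachable from } p \text{ in one move}\}$, where $\mathrm{mex}(S)$ is the least nonnegative integer not in $S$ and $\mathrm{mex}\{\}=0$. *)

(* Defs.v *)
From mathcomp Require Import all_boot.

Set Implicit Arguments.
Unset Strict Implicit.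
Unset Printing Implicit Defensive.

(* An unordered pair of pile sizes is represented by either of its two
   orderings: the rules below are symmetric in the two piles (moveC), and so
   the Grundy value does not depend on the ordering chosen (grundyC). *)
Definition position := (nat * nat)%type.

Definition swap (p : position) : position := (p.2, p.1).

(* The two non-strict comparisons p.2 <= p.1 and p.1 <= p.2 both hold when the
   piles are equal, in which case either pile may be reduced. *)
Definition move (p q : position) : bool :=
  [|| [&& p.2 <= p.1, q.1 < p.1 & q.2 == p.2],
      [&& p.1 <= p.2, q.1 == p.1 & q.2 < p.2]
    | [&& q.1 < p.1, q.2 < p.2 & p.1 - q.1 == p.2 - q.2]].

(* No move increases a pile, so searching this finite box finds every option
   (mem_options). *)
Definition options (p : position) : seq position :=
  [seq q <- [seq (x, y) | x <- iota 0 p.1.+1, y <- iota 0 p.2.+1] | move p q].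

Lemma mem_options p q : (q \in options p) = move p q.
Proof.
rewrite mem_filter; case Hm: (move p q); rewrite ?andFb // andTb.
apply/idP/allpairsPdep; exists q.1, q.2; rewrite !mem_iota !add0n !ltnS.
case: p q Hm => [a b] [x y]; rewrite /move /= => /or3P Hm.
by case: Hm => /and3P [];
  [move=> _ /ltnW -> /eqP -> | move=> _ /eqP -> /ltnW -> | move=> /ltnW -> /ltnW -> _].
Qed.

Lemma moveC p q : move (swap p) (swap q) = move p q.
Proof.
case: p q => [a b] [x y]; rewrite /move /=.
rewrite (eq_sym (b - y)) (andbC (y == b)) (andbC (x < a) (y == b)) orbCA.
by rewrite (andbC (y < b) (x == a)) (andbCA (y < b)).
Qed.

Lemma move_lt p q : move p q -> q.1 + q.2 < p.1 + p.2.
Proof.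
case: p q => [a b] [x y]; rewrite /move /=.
case/or3P => /and3P [].
- by move=> _ lt_xa /eqP ->; rewrite ltn_add2r.
- by move=> _ /eqP -> lt_yb; rewrite ltn_add2l.
- by move=> lt_xa lt_yb _; rewrite -addSn leq_add // ltnW.
Qed.

Lemma ex_notin (s : seq nat) : exists n, n \notin s.
Proof.
exists (sumn s).+1; apply/negP => Hs.
suff: forall t n, n \in t -> n <= sumn t by move/(_ _ _ Hs); rewrite ltnn.
elim=> [|x t IH] n //=; rewrite inE => /orP [/eqP ->|/IH le_n].
  exact: leq_addr.
exact: leq_trans le_n (leq_addl _ _).
Qed.

Definition mex (s : seq nat) : nat := ex_minn (ex_notin s).

Lemma eq_mex s t : s =i t -> mex s = mex t.
Proof.
move=> est; rewrite /mex; case: ex_minnP => m ms mmin; case: ex_minnP => n nt nmin.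
by apply/eqP; rewrite eqn_leq mmin ?nmin -?est // est.
Qed.

(* The recursion is on a bound n on the length of play.  Since every move
   decreases the total number of tokens, the bound used in grundy is never
   reached, and grundyE is the defining recurrence. *)
Fixpoint grundy_upto (n : nat) (p : position) : nat :=
  if n is n'.+1 then mex [seq grundy_upto n' q | q <- options p] else 0.

Definition grundy (p : position) : nat := grundy_upto (p.1 + p.2).+1 p.

Lemma grundyE p : grundy p = mex [seq grundy q | q <- options p].
Proof.
have H n m q : q.1 + q.2 < n -> q.1 + q.2 < m -> grundy_upto n q = grundy_upto m q.
  elim: n m q => [|n IH] [|m] q //= ltn ltm; congr mex.
  apply/eq_in_map => r; rewrite mem_options => /move_lt lt_r.
  by apply: IH; apply: leq_trans lt_r _.
rewrite {1}/grundy /=; congr mex; apply/eq_in_map => q.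
by rewrite mem_options => /move_lt lt_q; apply: H.
Qed.

Lemma grundyC a b : grundy (a, b) = grundy (b, a).
Proof.
have swapK : involutive swap by case.
suff H n p : p.1 + p.2 < n -> grundy p = grundy (swap p) by apply: (H (a + b).+1).
elim: n p => [|n IH] p // ltp.
rewrite [LHS]grundyE [RHS]grundyE; apply: eq_mex => k.
apply/mapP/mapP => [] [q]; rewrite mem_options => Hq ->;
  exists (swap q); rewrite ?mem_options.
- by rewrite moveC.
- by apply: IH; apply: leq_trans (move_lt Hq) _.
- by rewrite -moveC swapK.
- have Hq' : move p (swap q) by rewrite -moveC swapK.
  by rewrite (IH (swap q)) ?swapK //; apply: leq_trans (move_lt Hq') _.
Qed.

(* Main.v *)
Require Import Defs.
From mathcomp Require Import all_boot.
From mathcomp Require Import zify.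

(** Positions on a common diagonal are joined by a move, which gives uniqueness.
    For existence, suppose that the value c is missed on diagonal a by every b in
    a box [0, N).  At most c of these b have a Grundy value below c; every other b
    has an option of value c, which must come from the pile a + b, and is thus
    either (b, d + b) with d < a, which happens for at most a values of b, or
    (y, b) with y < b.  Let S be the set of the b of the last kind.  Then y is
    outside S: otherwise (z, y) has value c for some z < y, but it is an option
    of (y, b).  Moreover b is determined by y, so |S| <= N - |S| <= a + c, which
    is absurd if N > 2(a + c). *)

Lemma grundy_move p q : move p q -> grundy p <> grundy q.
Proof.
move=> pq; rewrite [grundy p]grundyE /mex; case: ex_minnP => m m_notin _ Em.
by case/negP: m_notin; rewrite Em map_f // mem_options.
Qed.

Lemma grundy_option p c :
  c < grundy p -> exists2 q, move p q & grundy q = c.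
Proof.
rewrite grundyE /mex; case: ex_minnP => m _ m_min lt_cm.
have /mapP[q] : c \in [seq grundy q | q <- options p].
  by apply: contraLR lt_cm => /m_min; rewrite -leqNgt.
by rewrite mem_options => pq ->; exists q.
Qed.

Lemma grundy_diag_inj a : injective (fun b => grundy (b, a + b)).
Proof.
move=> b b' /= E; case: (ltngtP b b') => // lt_bb'; exfalso.
- by apply: (grundy_move (b', a + b') (b, a + b)) => //; rewrite /move /=; lia.
- by apply: (grundy_move (b, a + b) (b', a + b')) => //; rewrite /move /=; lia.
Qed.

(** As [y] is a largest pile, it may be lowered to any [z], even to one below [x]. *)
Lemma grundy_row x y z : x <= y -> z < y -> grundy (x, y) <> grundy (x, z).
Proof. by move=> le_xy lt_zy; apply: grundy_move; rewrite /move /=; lia. Qed.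

(** The first hypothesis only excludes [b' <= b], so that missing [c] in a finite box suffices. *)
Lemma grundy_row_option a b c :
    (forall b', grundy (b', a + b') = c -> b < b') -> c <= grundy (b, a + b) ->
  exists2 y, y < a + b & grundy (b, y) = c.
Proof.
move=> missed; rewrite leq_eqVlt => /predU1P[/esym/missed|]; first lia.
case/grundy_option => -[x y]; rewrite /move /= => /or3P[] /and3P[].
(* Lowering the pile [b] is legal only if [a = 0]; the piles are then equal, and swapping gives an
   option that keeps [b]. *)
- move=> le_ab lt_xb /eqP-> E; exists x; first lia.
  by rewrite grundyC -E; congr (grundy (_, _)); lia.
- by move=> _ /eqP-> lt_y; exists y.
- move=> lt_xb lt_y dxy.
  have -> : y = a + x by lia.
  by move/missed; lia.
Qed.

(** Choosing a related element of [B] for each element of [A] gives an injection. *)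
Lemma leq_card_rel (T U : finType) (A : {set T}) (B : {set U}) (R : T -> U -> bool) :
    {in A, forall x, exists2 y, y \in B & R x y} ->
    {in A &, forall x x' y, R x y -> R x' y -> x = x'} ->
  #|A| <= #|B|.
Proof.
move=> exR injR; pose f x := [pick y in B | R x y].
have fP x : x \in A -> exists2 y, y \in B & f x = Some y /\ R x y.
  move=> /exR[y By Rxy]; rewrite /f; case: pickP => [z /andP[]|/(_ y)].
    by exists z.
  by rewrite /= By Rxy.
have f_inj : {in A &, injective f}.
  move=> x x' Ax Ax'; case: (fP x Ax) => y _ [-> Rxy].
  case: (fP x' Ax') => y' _ [-> Rxy'] [Ey]; apply: injR Rxy _ => //.
  by rewrite Ey.
rewrite -(card_in_imset f_inj) -(card_imset (mem B) Some_inj).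
apply/subset_leq_card/subsetP => _ /imsetP[x /fP[y By [-> _]] ->].
exact: imset_f.
Qed.

Lemma grundy_diag_bound a c :
  exists2 b, b <= (a + c).*2 & grundy (b, a + b) = c.
Proof.
pose N := (a + c).*2.+1.
case: (pickP (fun b : 'I_N => grundy (b : nat, a + b) == c)) => [b /eqP Eb|missed].
  by exists b => //; rewrite -ltnS.
pose low := [set b : 'I_N | grundy (b : nat, a + b) < c].
pose near := [set b : 'I_N | [exists d : 'I_a, grundy (b : nat, d + b) == c]].
pose S := ~: (low :|: near).
have low_le : #|low| <= c.
  rewrite -[c]card_ord -cardsT.
  apply: (@leq_card_rel _ _ _ _
    (fun (b : 'I_N) (i : 'I_c) => grundy (b : nat, a + b) == i)).
    by move=> b; rewrite inE => lt_bc; exists (Ordinal lt_bc); rewrite ?inE.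
  move=> b b' _ _ i /eqP <- /eqP E.
  exact/val_inj/(grundy_diag_inj a).
have near_le : #|near| <= a.
  rewrite -[a]card_ord -cardsT.
  apply: (@leq_card_rel _ _ _ _
    (fun (b : 'I_N) (d : 'I_a) => grundy (b : nat, d + b) == c)).
    by move=> b; rewrite inE => /existsP[d Ed]; exists d; rewrite ?inE.
  move=> b b' _ _ d /eqP <- /eqP E.
  exact/val_inj/(grundy_diag_inj d).
have S_row b : b \in S -> exists2 y : 'I_N, y < b & grundy (y : nat, b : nat) = c.
  rewrite !inE negb_or -leqNgt => /andP[le_c far].
  case: (@grundy_row_option a b c) => // [b' Eb'|y lt_y Ey].
    rewrite ltnNge; apply/negP => le_b'b.
    have := missed (Ordinal (leq_ltn_trans le_b'b (ltn_ord b))).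
    by rewrite /= Eb' eqxx.
  have [lt_yb|le_by] := ltnP y b.
    by exists (Ordinal (ltn_trans lt_yb (ltn_ord b))); rewrite //= grundyC.
  (* Here [y = d + b] with [d = y - b], which would put [b] in [near]. *)
  have lt_a : y - b < a by lia.
  by case/existsP: far; exists (Ordinal lt_a); rewrite /= subnK ?Ey.
have S_le : #|S| <= #|~: S|.
  apply: (@leq_card_rel _ _ _ _
    (fun b y : 'I_N => (y < b) && (grundy (y : nat, b : nat) == c))).
    move=> b /S_row[y lt_yb Ey]; exists y; last by rewrite lt_yb Ey eqxx.
    rewrite inE; apply/negP => /S_row[z lt_zy].
    rewrite grundyC -Ey => /esym; apply: grundy_row; first exact: ltnW.
    exact: ltn_trans lt_yb.
  move=> b b' _ _ y /andP[lt_yb /eqP Eb] /andP[lt_yb' /eqP Eb'].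
  (* Both [b] and [b'] exceed [y], so beside [y] the larger one could be lowered to the other, yet
     both positions have value [c]. *)
  apply: val_inj => /=; case: (ltngtP b b') => // lt_bb'; exfalso.
    by apply: (grundy_row _ _ _ (ltnW lt_yb') lt_bb'); rewrite Eb.
  by apply: (grundy_row _ _ _ (ltnW lt_yb) lt_bb'); rewrite Eb.
have SC : #|~: S| <= a + c.
  by rewrite setCK addnC (leq_trans (leq_card_setU _ _)) // leq_add.
by exfalso; have := cardsC S; rewrite card_ord; lia.
Qed.

Theorem theorem2p8 (a c : nat) : exists! b : nat, grundy (b, a + b) = c.
Proof.
have [b _ Eb] := grundy_diag_bound a c.
by exists b; split=> // b' Eb'; apply: (grundy_diag_inj a); rewrite Eb Eb'.
Qed.
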